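(* There is a universal constant $K>0$ such that for every positive integer $N$, every $Z\subseteq\{0,1\}^N$ and every function $f:Z\to\{0,1\}$, $$Q(f)\le K\cdot \mathcal{LG}^{\mathrm{ext}}(f),$$ i.e. $Q(f)=O(\mathcal{LG}^{\mathrm{ext}}(f))$, where $Q(f)$ is the bounded-error quantum query complexity of $f$ and $\mathcal{LG}^{\mathrm{ext}}(f)$ is the extended learning graph complexity of $f$.
   Context: Quantum query complexity: $Q(f)$ is the minimum number of queries (in superposition) to the bits $z_i$, $i\in[N]$, of the input $z\in Z$ needed by a quantum algorithm to output $f(z)$ with error probability at most $1/3$ on every $z\in Z$. For $S\subseteq[N]$, $z_S$ is the restriction of $z$ to the positions in $S$. A $1$-certificate for $f$ on $y\in f^{-1}(1)$ is a set $I\subseteq[N]$ such that $f(z)=1$ for every $z\in Z$ with $z_I=y_I$. Extended learning graph. Let $Y\subseteq Z\subseteq\{0,1\}^N$. An extended learning graph $\mathcal G$ is a $5$-tuple $(\mathcal V,\mathcal E,\mathcal S,\{w_z^b: z\in Z,b\in\{0,1\}\},\{p_y:y\in Y\})$ such that: (i) $(\mathcal V,\mathcal E)$ is a (finite) directed acyclic graph rooted at some $r\in\mathcal V$; (ii) $\mathcal S$ maps each $v\in\mathcal V$ to $\mathcal S(v)\subseteq[N]$, with $\mathcal S(r)=\emptyset$ and, for every $(u,v)\in\mathcal E$, $\mathcal S(v)=\mathcal S(u)\cup\{j\}$ for some $j\notin\mathcal S(u)$; (iii) for every $(u,v)\in\mathcal E$, the weights $w_z^b(u,v)$ are in $\mathbb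 R_{\ge0}$ and depend on $z$ only through $z_{\mathcal S(v)}$; (iv) $w_x^0(u,v)=w_y^1(u,v)$ for all $x\in Z\setminus Y$, $y\in Y$ and $(u,v)\in\mathcal E$ with $\mathcal S(v)=\mathcal S(u)\cup\{j\}$, $x_{\mathcal S(u)}=y_{\mathcal S(u)}$ and $x_j\ne y_j$; (v) for every $y\in Y$, $p_y:\mathcal E\to\mathbb R_{\ge0}$ is a unit flow whose source is the root, with $p_y(e)=0$ whenever $w_y^1(e)=0$. $\mathcal G$ is an extended learning graph for $f:Z\to\{0,1\}$ if $Y=f^{-1}(1)$ and, for every $y\in Y$, the label of each sink of $p_y$ contains a $1$-certificate for $f$ on $y$. Complexity. For $x\in f^{-1}(0)$ and $y\in f^{-1}(1)$, let $C^0(\mathcal G,x)=\sum_{e\in\mathcal E}w_x^0(e)$ and $C^1(\mathcal G,y)=\sum_{e\in\mathcal E}p_y(e)^2/w_y^1(e)$ (terms with $p_y(e)=0$ count as $0$). Put $C^0(\mathcal G)=\max_{x\in f^{-1}(0)}C^0(\mathcal G,x)$, $C^1(\mathcal G)=\max_{y\in f^{-1}(1)}C^1(\mathcal G,y)$ (a maximum over the empty set is $0$), and $C(\mathcal G)=\sqrt{C^0(\mathcal G)C^1(\mathcal G)}$. The extended learning graph complexity $\mathcal{LG}^{\mathrm{ext}}(f)$ is the minimum (infimum) of $C(\mathcal G)$ over all extended learning graphs $\mathcal G$ for $f$. *)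

(* Defs.v *)
From HB Require Import structures.
From mathcomp Require Import all_boot all_order all_algebra.
From mathcomp Require Import complex.
From mathcomp Require Import all_classical all_reals all_analysis.

Set Implicit Arguments.
Unset Strict Implicit.
Unset Printing Implicit Defensive.

Import Order.TTheory GRing.Theory Num.Theory.
Local Open Scope ring_scope.

Notation bitstring N := {ffun 'I_N -> bool}.

(* [f : {z in Z} -> bool] is a partial Boolean function with domain [Z].  The
   restrictions of [x] and [y] to [S] are equal iff [{in S, val x =1 val y}].  *)

(* A query algorithm acts on the Hilbert space with orthonormal basis the triples
   (i, b, a): queried position, answer bit, workspace content.  Coordinates of
   matrices and vectors are matched with basis triples by [enum_val] and
   [enum_rank]. *)
Notation qbasis N W := ('I_N * bool * W)%type.

Definition query (N : nat) (W : finType) (z : bitstring N)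
    (a : qbasis N W) : qbasis N W :=
  let: (i, b, c) := a in (i, b (+) z i, c).

Definition oracle (R : realType) (N : nat) (W : finType) (z : bitstring N) :
    'M[R[i]]_#|{: qbasis N W}| :=
  \matrix_(k, l) (enum_val k == query z (enum_val l))%:R.

(* The algorithm does not fix its number of queries: run with [T] queries, it uses
   only the unitaries of index at most [T]. *)
Record query_algorithm (R : realType) (N : nat) := QueryAlgorithm {
  qa_work : finType;
  qa_init : qbasis N qa_work;
  qa_unitary : nat -> 'M[R[i]]_#|{: qbasis N qa_work}|;
  qa_unitaryP : forall t, qa_unitary t \is unitarymx;
  qa_output : qbasis N qa_work -> bool }.

Fixpoint qa_state (R : realType) (N : nat) (A : query_algorithm R N)
    (z : bitstring N) (T : nat) : 'cV[R[i]]_#|{: qbasis N (qa_work A)}| :=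
  match T with
  | 0%N => qa_unitary A 0 *m delta_mx (enum_rank (qa_init A)) 0
  | T'.+1 => qa_unitary A T'.+1 *m (oracle R (qa_work A) z *m qa_state A z T')
  end.

(* Probability of an output different from [b] after [T] queries to [z], when the
   final state is measured in the basis of triples. *)
Definition error_probability (R : realType) (N : nat) (A : query_algorithm R N)
    (T : nat) (z : bitstring N) (b : bool) : R[i] :=
  \sum_(k | qa_output (enum_val k) != b) `|qa_state A z T k 0| ^+ 2.

Definition computes (R : realType) (N : nat) (A : query_algorithm R N) (T : nat)
    (Z : {set bitstring N}) (f : {z in Z} -> bool) : Prop :=
  forall z : {z in Z}, error_probability A T (val z) (f z) <= 3%:R^-1.

(* Taken in the extended reals so that no junk value arises if the set is empty. *)
Definition quantum_query_complexity (R : realType) (N : nat)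
    (Z : {set bitstring N}) (f : {z in Z} -> bool) : \bar R :=
  ereal_inf [set q : \bar R | exists2 T : nat,
    exists A : query_algorithm R N, computes A T f & q = (T%:R)%:E]%classic.

Section Flows.
Variables (R : realType) (V : finType) (edge : rel V) (p : V -> V -> R).

Definition inflow (v : V) : R := \sum_(u | edge u v) p u v.
Definition outflow (v : V) : R := \sum_(u | edge v u) p v u.

Definition flow_sink (v : V) : Prop := outflow v < inflow v.

Definition unit_flow_from (r : V) : Prop :=
  [/\ forall u v, edge u v -> 0 <= p u v,
      outflow r - inflow r = 1
    & forall v, v != r -> outflow v <= inflow v].
End Flows.

(* [w b z u v] is the weight w_z^b(u, v), with [b = true] standing for 1; [w] and
   the flows [p y] are relevant only on edges, and [p y] only for [y] in [Y]. *)
Record ext_learning_graph (R : realType) (N : nat) (Z : {set bitstring N})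
    (Y : {set {z in Z}}) := ExtLearningGraph {
  lg_vertex : finType;
  lg_edge : rel lg_vertex;
  lg_root : lg_vertex;
  lg_label : lg_vertex -> {set 'I_N};
  lg_w : bool -> {z in Z} -> lg_vertex -> lg_vertex -> R;
  lg_p : {z in Z} -> lg_vertex -> lg_vertex -> R;
  lg_acyclic : forall u v, lg_edge u v -> ~~ connect lg_edge v u;
  lg_rooted : forall v, connect lg_edge lg_root v;
  lg_label_root : lg_label lg_root = finset.set0;
  lg_label_edge : forall u v, lg_edge u v ->
    exists2 j, j \notin lg_label u & lg_label v = j |: lg_label u;
  lg_w_ge0 : forall b z u v, lg_edge u v -> 0 <= lg_w b z u v;
  lg_w_local : forall b (z z' : {z in Z}) u v, lg_edge u v ->
    {in lg_label v, val z =1 val z'} -> lg_w b z u v = lg_w b z' u v;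
  lg_w_compat : forall (x y : {z in Z}) u v j,
    x \notin Y -> y \in Y -> lg_edge u v -> lg_label v = j |: lg_label u ->
    {in lg_label u, val x =1 val y} -> val x j != val y j ->
    lg_w false x u v = lg_w true y u v;
  lg_p_flow : forall y, y \in Y -> unit_flow_from lg_edge (lg_p y) lg_root;
  lg_p_supp : forall y u v, y \in Y -> lg_edge u v ->
    lg_w true y u v = 0 -> lg_p y u v = 0 }.

Definition certificate1 (N : nat) (Z : {set bitstring N}) (f : {z in Z} -> bool)
    (y : {z in Z}) (I : {set 'I_N}) : Prop :=
  forall z : {z in Z}, {in I, val z =1 val y} -> f z.

Section LearningGraphComplexity.
Variables (R : realType) (N : nat) (Z : {set bitstring N}) (f : {z in Z} -> bool).
Let graph := ext_learning_graph R [set y | f y]%SET.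

Definition lg_for (G : graph) : Prop :=
  forall y v, f y -> flow_sink (@lg_edge _ _ _ _ G) (lg_p y) v ->
    exists2 I : {set 'I_N}, I \subset lg_label v & certificate1 f y I.

Definition lg_C0_at (G : graph) (x : {z in Z}) : R :=
  \sum_(e : lg_vertex G * lg_vertex G | lg_edge e.1 e.2) lg_w false x e.1 e.2.

(* Terms with zero flow vanish also when the weight is zero, since [0^-1 = 0]. *)
Definition lg_C1_at (G : graph) (y : {z in Z}) : R :=
  \sum_(e : lg_vertex G * lg_vertex G | lg_edge e.1 e.2)
    lg_p y e.1 e.2 ^+ 2 / lg_w true y e.1 e.2.

Definition lg_C0 (G : graph) : R := \big[Num.max/0]_(x | ~~ f x) lg_C0_at G x.
Definition lg_C1 (G : graph) : R := \big[Num.max/0]_(y | f y) lg_C1_at G y.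
Definition lg_C (G : graph) : R := Num.sqrt (lg_C0 G * lg_C1 G).

Definition ext_lg_complexity : \bar R :=
  ereal_inf [set c : \bar R | exists2 G : graph, lg_for G & c = (lg_C G)%:E]%classic.
End LearningGraphComplexity.

(* Main.v *)
(* Put w_x^0 and p_y, w_y^1 into vectors v_{z,j} supported on the edges loading j,
   tagged by the restriction of z to the label of the tail: v_x carries sqrt(w_x^0)
   and v_y carries p_y / sqrt(w_y^1).  For f(x) = 0 and f(y) = 1, the sum over j
   with x_j <> y_j of <v_{x,j}, v_{y,j}> is the flow p_y through the cut between the
   vertices whose label does not distinguish x from y and the others.  No sink is
   on the root's side, as its label contains a certificate, so the sum is 1.  By
   Cauchy-Schwarz C^0 C^1 >= 1 unless f is constant.

   Let Pi_z project onto e and the vectors |j, z_j, _>, let M fix the vectors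
   psi_y = e + c sum_j |j, y_j> v_{y,j} and negate their orthogonal complement,
   which contains phi_x = e - c^-1 sum_j |j, 1 - x_j> v_{x,j}.  With
   U = (2 Pi_z - 1) M, two queries each, U psi_y = psi_y for z = y, while for z = x
   phi_x - U phi_x = 2 Pi_x phi_x = 2 e.  Hence the mean of e, U e, ..., U^(T-1) e is
   (phi_x - U^T phi_x) / (2T) for z = x, of norm at most |phi_x| / T, but has inner
   product 1 with psi_y for z = y.  No spectral gap estimate or phase estimation is
   needed: the mean is produced by a control register in uniform superposition. *)

Require Import Defs.
From mathcomp Require Import all_boot all_order all_algebra complex ring lra.
From mathcomp Require Import all_classical all_reals all_analysis.

Set Implicit Arguments.
Unset Strict Implicit.
Unset Printing Implicit Defensive.

Import Order.TTheory GRing.Theory Num.Theory.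
Local Open Scope ring_scope.

(** * Reflections *)

Section Reflections.
Variable R : realFieldType.

Definition dot n (x y : 'cV[R]_n) : R := (x^T *m y) 0 0.

Lemma dotE n (x y : 'cV[R]_n) : dot x y = \sum_i x i 0 * y i 0.
Proof. by rewrite /dot mxE; apply: eq_bigr => i _; rewrite mxE. Qed.

Lemma dotC n (x y : 'cV[R]_n) : dot x y = dot y x.
Proof. by rewrite !dotE; apply: eq_bigr => i _; rewrite mulrC. Qed.

Lemma dotDr n (x y z : 'cV[R]_n) : dot x (y + z) = dot x y + dot x z.
Proof. by rewrite /dot mulmxDr mxE. Qed.

Lemma dotZr n a (x y : 'cV[R]_n) : dot x (a *: y) = a * dot x y.
Proof. by rewrite /dot -scalemxAr mxE. Qed.

Lemma dotNr n (x y : 'cV[R]_n) : dot x (- y) = - dot x y.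
Proof. by rewrite /dot mulmxN mxE. Qed.

Lemma dotDl n (x y z : 'cV[R]_n) : dot (x + y) z = dot x z + dot y z.
Proof. by rewrite dotC dotDr !(dotC z). Qed.

Lemma dotZl n a (x y : 'cV[R]_n) : dot (a *: x) y = a * dot x y.
Proof. by rewrite dotC dotZr dotC. Qed.

Lemma dotNl n (x y : 'cV[R]_n) : dot (- x) y = - dot x y.
Proof. by rewrite dotC dotNr dotC. Qed.

Definition dot_lin := (dotDl, dotDr, dotNl, dotNr, dotZl, dotZr).

Lemma dot_mulmxl n (A : 'M[R]_n) (x y : 'cV[R]_n) :
  dot (A *m x) y = dot x (A^T *m y).
Proof. by rewrite /dot trmx_mul mulmxA. Qed.

Lemma dot_ge0 n (x : 'cV[R]_n) : 0 <= dot x x.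
Proof. by rewrite dotE; apply: sumr_ge0 => i _; rewrite -expr2 sqr_ge0. Qed.

Lemma dot_eq0 n (x : 'cV[R]_n) : (dot x x == 0) = (x == 0).
Proof.
apply/eqP/eqP => [|->]; last by rewrite /dot mulmx0 mxE.
rewrite dotE => /psumr_eq0P x0; apply/colP => i; rewrite mxE.
by apply/eqP; rewrite -sqrf_eq0 expr2 x0// => j _; rewrite -expr2 sqr_ge0.
Qed.

Lemma outer_mulmx n (x y z : 'cV[R]_n) : x *m y^T *m z = dot y z *: x.
Proof. by rewrite -mulmxA [y^T *m z]mx11_scalar mul_mx_scalar. Qed.

Definition reflection n (M : 'M[R]_n) := M^T = M /\ M *m M = 1%:M.

Lemma dot_reflection n (M : 'M[R]_n) (x y : 'cV[R]_n) :
  reflection M -> dot (M *m x) (M *m y) = dot x y.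
Proof. by case=> MT M2; rewrite dot_mulmxl MT mulmxA M2 mul1mx. Qed.

(* The span of [s] grows by one vector [a] at a time: [a - M a] is twice the
   component of [a] orthogonal to the previous span, and its sign is flipped. *)
Lemma span_reflection n (s : seq 'cV[R]_n) :
  exists2 M : 'M[R]_n, reflection M &
    (forall x, x \in s -> M *m x = x) /\
    (forall x, (forall y, y \in s -> dot y x = 0) -> M *m x = - x).
Proof.
elim: s => [|a s [M [MT M2] [Mfix Mneg]]].
  exists (- 1%:M).
    by split; [rewrite linearN /= trmx1 | rewrite mulNmx mul1mx opprK].
  by split=> // x _; rewrite mulNmx mul1mx.
have [Ma|Ma] := eqVneq (M *m a) a.
  exists M => //; split=> x.
    by rewrite inE => /predU1P[->//|/Mfix].
  by move=> xs; apply: Mneg => y ys; apply: xs; rewrite inE ys orbT.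
pose e := a - M *m a.
have e0 : dot e e != 0 by rewrite dot_eq0 subr_eq0 eq_sym.
have Me : M *m e = - e by rewrite mulmxBr mulmxA M2 mul1mx opprB.
have eM x : dot e (M *m x) = - dot e x by rewrite -{1}MT -dot_mulmxl Me dotNl.
have ea : dot e e = 2 * dot e a.
  by rewrite {2}/e dotDr dotNr eM; ring.
(* [M] negates [e]. Adding [c *: (e *m e^T)], twice the projection onto the line of [e], makes [e]
   fixed and changes nothing orthogonal to it. *)
pose c := 2 / dot e e.
exists (M + c *: (e *m e^T)); [split|split].
- by rewrite linearD /= linearZ /= trmx_mul trmxK MT.
- have eTM : e^T *m M = - e^T by rewrite -{1}MT -trmx_mul Me linearN.
  rewrite mulmxDl !mulmxDr M2 -!scalemxAl -!scalemxAr !mulmxA Me -mulmxA eTM.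
  rewrite outer_mulmx -scalemxAl mulNmx mulmxN scalerA [in X in _ + X]scalerA.
  rewrite -addrA -[RHS]addr0; congr (_ + _).
  rewrite !scalerN addrA -opprD -scalerDl -scaleNr -scalerDl.
  suff -> : - (c + c) + c * (c * dot e e) = 0 by rewrite scale0r.
  by rewrite /c divfK//; ring.
- move=> x; rewrite mulmxDl -scalemxAl outer_mulmx scalerA inE => /predU1P[->|xs].
    by rewrite /c mulrAC -ea divff// scale1r addrC subrK.
  have -> : dot e x = 0.
    have := eM x; rewrite Mfix// => /eqP; rewrite -addr_eq0 -mulr2n.
    by rewrite mulrn_eq0 => /eqP.
  by rewrite mulr0 scale0r addr0 Mfix.
- move=> x xs; have Mx : M *m x = - x.
    by apply: Mneg => y ys; apply: xs; rewrite inE ys orbT.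
  rewrite mulmxDl -scalemxAl outer_mulmx Mx.
  have -> : dot e x = 0.
    by rewrite dotDl dotNl dot_mulmxl MT Mx dotNr opprK xs ?mem_head// addr0.
  by rewrite scale0r scaler0 addr0.
Qed.

(** Equal norms make [a + b] and [a - b] orthogonal, so the reflection about the line of [a + b]
    negates [a - b] and sends [a], half of their sum, to [b]. *)
Lemma reflection_swap n (a b : 'cV[R]_n) : dot a a = dot b b ->
  exists2 M : 'M[R]_n, reflection M & M *m a = b.
Proof.
move=> ab; have [M reflM [Mfix Mneg]] := span_reflection [:: a + b].
exists M => //.
have Mp : M *m (a + b) = a + b by rewrite Mfix ?mem_head.
have Mm : M *m (a - b) = - (a - b).
  apply: Mneg => y; rewrite inE => /eqP ->.
  by rewrite !dot_lin ab (dotC b a); ring.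
have two : (2 : R) != 0 by rewrite pnatr_eq0.
apply: (scalerI two); rewrite scalemxAr.
have -> : 2 *: a = (a + b) + (a - b) by rewrite scaler_nat mulr2n addrACA subrr addr0.
by rewrite mulmxDr Mp Mm opprB addrC addrA subrK scaler_nat mulr2n.
Qed.
End Reflections.

(** * Mean of an orbit under the product of two reflections *)

Section WalkMean.
Variables (R : realFieldType) (n : nat) (F M : 'M[R]_n) (e : 'cV[R]_n).
Hypotheses (reflF : reflection F) (reflM : reflection M).

Definition walk (t : nat) (x : 'cV[R]_n) := iter t (fun y => F *m (M *m y)) x.

Definition walk_mean (T : nat) := T%:R^-1 *: \sum_(t < T) walk t e.

Lemma dot_walk t x y : dot (walk t x) (walk t y) = dot x y.
Proof. by elim: t => //= t IH; rewrite !dot_reflection. Qed.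

(** The walk is an isometry fixing [psi], so [psi] has inner product 1 with the whole orbit and with
    its mean; a short [psi] then forces a long mean. *)
Lemma walk_mean_accept T psi : (0 < T)%N -> F *m psi = psi -> M *m psi = psi ->
  dot psi e = 1 -> dot psi psi <= 3 / 2 ->
  2 / 3 <= dot (walk_mean T) (walk_mean T).
Proof.
move=> T0 Fpsi Mpsi psie psi2.
have wpsi t : walk t psi = psi by elim: t => //= t ->; rewrite Mpsi.
have psim : dot psi (walk_mean T) = 1.
  rewrite dotZr /dot mulmx_sumr summxE (eq_bigr (fun=> 1)) => [|t _].
    by rewrite sumr_const card_ord mulVf// pnatr_eq0 -lt0n.
  by rewrite -/(dot psi _) -{1}(wpsi t) dot_walk.
move: (walk_mean T) psim => m psim.
(* The multiple [3 / 2] of [m] is the one for which expanding the square gives exactly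
   [2 / 3 <= dot m m]. *)
have := dot_ge0 (psi + (- (3 / 2)) *: m).
rewrite !dot_lin (dotC m psi) psim; lra.
Qed.

(* The hypotheses on [phi] say that [e] is half of [phi - U phi], where
   [U = F M] is the step of the walk, so the sum of the orbit of [e] telescopes. *)
Lemma walk_mean_reject T phi : (0 < T)%N -> F *m phi = 2 *: e - phi ->
  M *m phi = - phi -> 3 * dot phi phi <= T%:R ^+ 2 ->
  dot (walk_mean T) (walk_mean T) <= 3^-1.
Proof.
move=> T0 Fphi Mphi phi2.
have walkD t (x y : 'cV[R]_n) : walk t (x + y) = walk t x + walk t y.
  by elim: t => //= t ->; rewrite !mulmxDr.
have walkZ t a (x : 'cV[R]_n) : walk t (a *: x) = a *: walk t x.
  by elim: t => //= t ->; rewrite -!scalemxAr.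
have walkN t (x : 'cV[R]_n) : walk t (- x) = - walk t x.
  by rewrite -scaleN1r walkZ scaleN1r.
have e_telescopes : e = 2^-1 *: (phi - walk 1 phi).
  rewrite /= Mphi mulmxN Fphi opprK addrC subrK.
  by rewrite scalerA mulVf ?pnatr_eq0// scale1r.
have sum_walk : \sum_(t < T) walk t e = 2^-1 *: (phi - walk T phi).
  elim: T {T0 phi2} => [|T IH]; first by rewrite big_ord0 subrr scaler0.
  rewrite big_ord_recr /= IH {1}e_telescopes (walkZ T) -scalerDr; congr (_ *: _).
  rewrite (walkD T) walkN -[walk T (walk 1 phi)]iterD addn1.
  by rewrite addrA subrK.
have T2 : (0 : R) < T%:R ^+ 2 by rewrite exprn_gt0// ltr0n.
rewrite /walk_mean sum_walk !dotZl !dotZr !mulrA.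
set d := dot _ _.
(* Parallelogram law, as [phi] and [walk T phi] have the same norm. *)
have dle : d <= 4 * dot phi phi.
  have := dot_ge0 (phi + walk T phi).
  by rewrite /d !dot_lin dot_walk; lra.
rewrite (_ : _ * d = d / 4 / T%:R ^+ 2); last first.
  by field; rewrite pnatr_eq0 -lt0n.
rewrite ler_pdivrMr//; lra.
Qed.
End WalkMean.

(** * Walks as query algorithms *)

Section RealKernels.
Variables (R : realType) (B : finType).
Local Open Scope complex_scope.

(** Real kernels indexed by the basis itself stand for complex matrices indexed by ordinals;
    unitarity becomes orthonormality of real rows. *)
Definition kermx (K : B -> B -> R) : 'M[R[i]]_#|B| :=
  \matrix_(k, l) (K (enum_val k) (enum_val l))%:C.

Definition kervec (F : B -> R) : 'cV[R[i]]_#|B| := \col_k (F (enum_val k))%:C.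

Lemma sum_enum_val (V : nmodType) (G : B -> V) (P : pred B) :
  \sum_(k : 'I_#|B| | P (enum_val k)) G (enum_val k) = \sum_(b | P b) G b.
Proof.
rewrite [RHS]big_mkcond [LHS]big_mkcond/=.
by rewrite -(big_enum_val (A := predT) (fun b => if P b then G b else 0)).
Qed.

Lemma mul_kermx_kervec K F :
  kermx K *m kervec F = kervec (fun a => \sum_b K a b * F b).
Proof.
apply/colP => k; rewrite !mxE rmorph_sum /= -(sum_enum_val _ predT)/=.
by apply: eq_bigr => l _; rewrite !mxE rmorphM.
Qed.

Lemma kermx_unitary K :
  (forall a b, \sum_c K a c * K b c = (a == b)%:R) -> kermx K \is unitarymx.
Proof.
move=> KK; apply/unitarymxP/matrixP => k l; rewrite !mxE.
rewrite -(inj_eq enum_val_inj) -[RHS](rmorph_nat (real_complex R)) /= -KK.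
rewrite rmorph_sum /= -(sum_enum_val _ predT)/=; apply: eq_bigr => i _.
by rewrite !mxE rmorphM /=; congr (_ * _); exact: conjc_real.
Qed.

Lemma kervec_delta a : kervec (fun b => (b == a)%:R) = delta_mx (enum_rank a) 0.
Proof.
apply/colP => k; rewrite !mxE andbT rmorph_nat; congr (_%:R).
by rewrite -(inj_eq enum_rank_inj) enum_valK.
Qed.

Lemma norm_kervec F k : `|kervec F k 0| ^+ 2 = (F (enum_val k) ^+ 2)%:C.
Proof. by rewrite mxE normc_def /= expr0n addr0 -rmorphXn /= sqr_sqrtr ?sqr_ge0. Qed.
End RealKernels.

(** * Superpositions of walks indexed by a control register *)

Section BranchedWalk.
Variables (R : realType) (N n : nat) (W : finType).
Local Notation H := (qbasis N W).
Local Notation B := (qbasis N (W * 'I_n.+1)%type).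

Definition branch (a : B) : 'I_n.+1 := a.2.2.
Definition site (a : B) : H := (a.1, a.2.1).
Definition glue (h : H) (t : 'I_n.+1) : B := (h.1, (h.2, t)).

Lemma branch_glue h t : branch (glue h t) = t. Proof. by []. Qed.

Lemma site_glue h t : site (glue h t) = h. Proof. by case: h. Qed.

Lemma eq_branch_site a b : (a == b) = (branch a == branch b) && (site a == site b).
Proof.
move: a b => [p [c t]] [p' [c' t']] /=.
by rewrite /branch /site !xpair_eqE; case: (p == p'); case: (c == c'); case: (t == t').
Qed.

Lemma sum_glue (V : nmodType) (G : B -> V) :
  \sum_a G a = \sum_t \sum_h G (glue h t).
Proof.
rewrite pair_big /=; apply: (reindex (fun th => glue th.2 th.1)).
by exists (fun a => (branch a, site a)) => [[t [p c]]|[p [c t]]] _.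
Qed.

(** Direct sum of one walk vector per branch. On such sums [branch_op] is block diagonal and
    [mix_op] is [Q] tensored with the identity. *)
Definition bstate (X : 'I_n.+1 -> 'cV[R]_#|{: H}|) (a : B) : R :=
  X (branch a) (enum_rank (site a)) 0.

Definition branch_op (Ms : 'I_n.+1 -> 'M[R]_#|{: H}|) (a b : B) : R :=
  (branch a == branch b)%:R *
  Ms (branch a) (enum_rank (site a)) (enum_rank (site b)).

Definition mix_op (Q : 'M[R]_n.+1) (a b : B) : R :=
  (site a == site b)%:R * Q (branch a) (branch b).

Lemma sum_enum_rank (V : nmodType) (G : 'I_#|{: H}| -> V) :
  \sum_h G (enum_rank h) = \sum_k G k.
Proof.
rewrite -(sum_enum_val (fun h => G (enum_rank h)) predT)/=.
by apply: eq_bigr => k _; rewrite enum_valK.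
Qed.

Lemma branch_op_apply Ms X : kermx (branch_op Ms) *m kervec (bstate X) =
  kervec (bstate (fun t => Ms t *m X t)).
Proof.
rewrite mul_kermx_kervec; congr kervec; apply/funext => a.
rewrite /bstate mxE sum_glue (bigD1 (branch a))//= [X in _ + X]big1 => [|t ta].
  rewrite addr0 -sum_enum_rank; apply: eq_bigr => h _.
  by rewrite /branch_op branch_glue site_glue eqxx mul1r.
rewrite big1// => h _; rewrite /branch_op branch_glue.
by rewrite eq_sym (negbTE ta) !mul0r.
Qed.

Lemma mix_op_apply Q X : kermx (mix_op Q) *m kervec (bstate X) =
  kervec (bstate (fun t => \sum_t' Q t t' *: X t')).
Proof.
rewrite mul_kermx_kervec; congr kervec; apply/funext => a.
rewrite /bstate summxE sum_glue; apply: eq_bigr => t _.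
rewrite (bigD1 (site a))//= big1 => [|h ha].
  by rewrite /mix_op branch_glue site_glue eqxx mul1r addr0 mxE.
by rewrite /mix_op site_glue eq_sym (negbTE ha) !mul0r.
Qed.

Lemma branch_op_unitary Ms : (forall t, reflection (Ms t)) ->
  kermx (branch_op Ms) \is unitarymx.
Proof.
move=> reflMs; apply: kermx_unitary => a b; rewrite eq_branch_site sum_glue.
have [MsT Ms2] := reflMs (branch a).
rewrite (bigD1 (branch a))//= [X in _ + X]big1 => [|t ta]; last first.
  by rewrite big1// => h _; rewrite /branch_op branch_glue eq_sym (negbTE ta) !mul0r.
rewrite addr0 /branch_op; have [ab|ab] := eqVneq; last first.
  by rewrite big1// => h _; rewrite mul0r mulr0.
have := congr1 (fun A : 'M[R]_#|{: H}| =>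
  A (enum_rank (site a)) (enum_rank (site b))) Ms2.
rewrite !mxE (inj_eq enum_rank_inj) /= => <-; rewrite -sum_enum_rank.
apply: eq_bigr => h _; rewrite branch_glue site_glue -ab eqxx !mul1r; congr (_ * _).
by rewrite -[in RHS]MsT mxE.
Qed.

Lemma mix_op_unitary Q : reflection Q -> kermx (mix_op Q) \is unitarymx.
Proof.
case=> QT Q2; apply: kermx_unitary => a b; rewrite eq_branch_site sum_glue.
have := congr1 (fun A : 'M[R]_n.+1 => A (branch a) (branch b)) Q2.
rewrite !mxE andbC => Qab.
transitivity ((site a == site b)%:R * (branch a == branch b)%:R : R); last first.
  by rewrite -natrM mulnb.
rewrite -Qab mulr_sumr; apply: eq_bigr => t _.
rewrite (bigD1 (site a))//= big1 => [|h ha]; last first.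
  by rewrite /mix_op site_glue eq_sym (negbTE ha) !mul0r.
rewrite addr0 /mix_op branch_glue site_glue eqxx mul1r eq_sym mulrCA.
by rewrite -[in Q (branch b) _]QT mxE.
Qed.

Definition query_mx (z : bitstring N) : 'M[R]_#|{: H}| :=
  \matrix_(k, l) (enum_val k == query z (enum_val l))%:R.

Lemma queryK (V : finType) z : involutive (@query N V z).
Proof. by case=> -[i b] c; rewrite /query -addbA addbb addbF. Qed.

(** A query leaves the control register alone and so acts alike in all branches. *)
Lemma oracle_bstate z X : oracle R (W * 'I_n.+1)%type z *m kervec (bstate X) =
  kervec (bstate (fun t => query_mx z *m X t)).
Proof.
have -> : oracle R (W * 'I_n.+1)%type z = kermx (fun a b => (a == query z b)%:R).
  by apply/matrixP => k l; rewrite !mxE rmorph_nat.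
rewrite mul_kermx_kervec; congr kervec; apply/funext => a.
rewrite (bigD1 (query z a))//= queryK eqxx mul1r big1 => [|b ba]; last first.
  by rewrite -(inj_eq (inv_inj (@queryK _ z))) queryK eq_sym in ba;
    rewrite (negbTE ba) mul0r.
have [branch_q site_q] : branch (query z a) = branch a /\
    site (query z a) = query z (site a) by move: (a) => [[i b] [c t]].
rewrite /bstate mxE branch_q site_q; move: (site a) => h.
rewrite (bigD1 (enum_rank (query z h)))// big1 => [|k].
  by rewrite !mxE !enum_rankK queryK eqxx mul1r.
rewrite -(inj_eq enum_val_inj) enum_rankK !mxE enum_rankK => ka.
by rewrite -(inj_eq (inv_inj (@queryK _ z))) queryK eq_sym (negbTE ka) mul0r.
Qed.
End BranchedWalk.

(** * The query algorithm that prepares and measures the mean *)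

Section WalkAlgorithm.
Variables (R : realType) (N n : nat) (W : finType).
Local Notation H := (qbasis N W).
Local Notation B := (qbasis N (W * 'I_n.+1)%type).
Variables (D M : 'M[R]_#|{: H}|) (h0 : H).
Hypotheses (reflD : reflection D) (reflM : reflection M).

(** Costs two queries; as a query is its own inverse, this is a conjugate of [D]. *)
Definition query_reflection (z : bitstring N) : 'M[R]_#|{: H}| :=
  query_mx R W z *m D *m query_mx R W z.

Lemma query_mxT (z : bitstring N) : (query_mx R W z)^T = query_mx R W z.
Proof.
apply/matrixP => k l; rewrite !mxE; congr (nat_of_bool _)%:R.
by rewrite -(inj_eq (inv_inj (@queryK _ W z))) queryK eq_sym.
Qed.

Lemma query_mxK (z : bitstring N) : query_mx R W z *m query_mx R W z = 1%:M.
Proof.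
apply/matrixP => k l; rewrite !mxE (bigD1 (enum_rank (query z (enum_val l))))//=.
rewrite !mxE enum_rankK queryK eqxx mulr1 big1 ?addr0 => [|i].
  by rewrite (inj_eq enum_val_inj).
rewrite -(inj_eq enum_val_inj) enum_rankK !mxE => /negbTE ->.
by rewrite mulr0.
Qed.

Lemma reflection_query z : reflection (query_reflection z).
Proof.
have [DT D2] := reflD; split; rewrite /query_reflection.
  by rewrite !trmx_mul query_mxT DT mulmxA.
rewrite !mulmxA -[_ *m query_mx R W z *m query_mx R W z]mulmxA query_mxK mulmx1.
by rewrite -[_ *m D *m D]mulmxA D2 mulmx1 query_mxK.
Qed.

Let e : 'cV[R]_#|{: H}| := delta_mx (enum_rank h0) 0.
Hypothesis query_start : forall z, query_reflection z *m e = e.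

(** The first basis vector and the uniform vector both have norm 1, so a reflection swaps them. It
    prepares the control register and later reads off the mean. *)
Lemma uniform_reflection : exists2 Q : 'M[R]_n.+1, reflection Q &
  forall t, Q t 0 = (Num.sqrt n.+1%:R)^-1.
Proof.
pose s : R := (Num.sqrt n.+1%:R)^-1.
have s2 : s * s *+ n.+1 = 1.
  by rewrite -invfM -expr2 sqr_sqrtr ?ler0n// -mulr_natr mulVf ?pnatr_eq0.
have [|Q reflQ Q0] := @reflection_swap R n.+1 (delta_mx 0 0) (const_mx s).
  rewrite !dotE [RHS](eq_bigr (fun=> s * s)) => [|i _]; last by rewrite !mxE.
  rewrite sumr_const card_ord s2 (bigD1 0)//= big1 => [|i /negbTE i0].
    by rewrite !mxE !eqxx mul1r addr0.
  by rewrite !mxE i0 mul0r.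
exists Q => // t; have := congr1 (fun x : 'cV_n.+1 => x t 0) Q0.
by rewrite -colE !mxE.
Qed.

Variable Q : 'M[R]_n.+1.
Hypotheses (reflQ : reflection Q)
  (Q_uniform : forall t, Q t 0 = (Num.sqrt n.+1%:R)^-1).

(** After an odd number of queries comes [D], the middle of a query reflection; after [2 s < 2 n]
    queries, [M] in the branches due to walk; after [2 n], the final mixing. *)
Definition round_op (m : nat) : 'M[R[i]]_#|{: B}| :=
  kermx (if m == n.*2 then mix_op Q
         else branch_op (fun t => if odd m then D
                                  else if (n <= m./2 + t)%N then M else 1%:M)).

(* Branch [t] idles in [h0] until its last [t] rounds, so that no control on the
   queries is needed: an idle branch is fixed by the query reflection. *)
Definition walk_unitary (m : nat) : 'M[R[i]]_#|{: B}| :=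
  if m is 0 then round_op 0 *m kermx (mix_op Q) else round_op m.

Lemma walk_unitaryP m : walk_unitary m \is unitarymx.
Proof.
have roundP k : round_op k \is unitarymx.
  rewrite /round_op; case: ifP => _; first exact: mix_op_unitary.
  apply: branch_op_unitary => t; case: ifP => // _; case: ifP => // _.
  by split; rewrite ?trmx1 ?mulmx1.
by case: m => //=; apply: mul_unitarymx => //; exact: mix_op_unitary.
Qed.

Definition walk_algorithm : query_algorithm R N :=
  QueryAlgorithm (glue h0 ord0) walk_unitaryP (fun a => branch a == ord0).

(** Truncated subtraction counts the steps: branch [t] waits [n - t] rounds, then walks. The last
    unitary is kept apart, since it belongs to the next round or to the final mixing. *)
Lemma walk_algorithm_state z s : (s <= n)%N ->
  qa_state walk_algorithm z s.*2 = round_op s.*2 *m kervec (bstate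
    (fun t => Q t 0 *: walk (query_reflection z) M (t + s - n) e)).
Proof.
elim: s => [_|s IH sn].
  rewrite /= -mulmxA; congr (_ *m _).
  rewrite -kervec_delta.
  have -> : (fun b : B => (b == glue h0 ord0)%:R : R) =
      bstate (fun t => (t == 0)%:R *: e).
    apply/funext => a; rewrite /bstate !mxE eq_branch_site branch_glue site_glue.
    by rewrite (inj_eq enum_rank_inj) andbT -natrM mulnb.
  rewrite mix_op_apply; congr kervec; congr bstate; apply/funext => t.
  rewrite (bigD1 0)//= big1 => [|i /negbTE ->]; last by rewrite scale0r scaler0.
  rewrite scale1r addr0 addn0; congr (_ *: _).
  by have /eqP -> : (t - n == 0)%N by rewrite subn_eq0 -ltnS.
rewrite doubleS /= -/(round_op _); congr (_ *m _).
have s2n : (s.*2 == n.*2) = false.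
  by rewrite (inj_eq double_inj); apply/eqP => sn'; rewrite sn' ltnn in sn.
have s2n' : (s.*2.+1 == n.*2) = false.
  by apply/eqP => /(congr1 odd); rewrite /= !odd_double.
rewrite IH ?(ltnW sn)// /round_op s2n s2n' /= odd_double doubleK.
rewrite branch_op_apply oracle_bstate branch_op_apply oracle_bstate.
congr kervec; congr bstate; apply/funext => t.
rewrite !mulmxA -/(query_reflection z) -!scalemxAr; congr (_ *: _).
rewrite -mulmxA; case: leqP => st.
  by rewrite addnS addnC subSn.
(* Here the branch still idles: both step counts truncate to 0. *)
have /eqP -> : (t + s - n == 0)%N by rewrite subn_eq0 addnC ltnW.
have /eqP -> : (t + s.+1 - n == 0)%N by rewrite subn_eq0 addnS addnC.
by rewrite mul1mx query_start.
Qed.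

(** The final mixing puts the mean into branch 0, the accepting one; the other branches share the
    remaining probability [1 - p]. *)
Lemma walk_algorithm_error z b :
  let p := dot (walk_mean (query_reflection z) M e n.+1)
               (walk_mean (query_reflection z) M e n.+1) in
  error_probability walk_algorithm n.*2 z b = (if b then 1 - p else p)%:C%C.
Proof.
move=> p; pose X t := Q t 0 *: walk (query_reflection z) M t e.
pose Y t := \sum_t' Q t t' *: X t'.
have YE : qa_state walk_algorithm z n.*2 = kervec (bstate Y).
  rewrite walk_algorithm_state// /round_op eqxx.
  rewrite mix_op_apply; congr kervec; congr bstate; apply/funext => t.
  by apply: eq_bigr => t' _; rewrite addnK.
have s2 : (Num.sqrt n.+1%:R)^-1 * (Num.sqrt n.+1%:R)^-1 = n.+1%:R^-1 :> R.
  by rewrite -invfM -expr2 sqr_sqrtr ?ler0n.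
have Y0 : dot (Y 0) (Y 0) = p.
  suff -> : Y 0 = walk_mean (query_reflection z) M e n.+1 by [].
  rewrite /walk_mean scaler_sumr; apply: eq_bigr => t _.
  rewrite scalerA; congr (_ *: _); rewrite Q_uniform.
  (* [Q] is symmetric, so its first row is uniform too. *)
  by have [<- _] := reflQ; rewrite mxE Q_uniform.
have sumY : \sum_t dot (Y t) (Y t) = 1.
  (* Mixing preserves the norm coordinate by coordinate; before it, each branch has squared norm
     [1 / (n + 1)]. *)
  transitivity (\sum_t dot (X t) (X t)).
    under eq_bigr do rewrite dotE; under [RHS]eq_bigr do rewrite dotE.
    rewrite exchange_big [RHS]exchange_big; apply: eq_bigr => h _ /=.
    pose x : 'cV[R]_n.+1 := \col_t X t h 0.
    have := dot_reflection x x reflQ; rewrite !dotE => Qx.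
    rewrite [RHS](eq_bigr (fun t => x t 0 * x t 0)) => [|t _]; last by rewrite !mxE.
    rewrite -Qx; apply: eq_bigr => t _; rewrite !mxE /Y summxE.
    by congr (_ * _); apply: eq_bigr => t' _; rewrite !mxE.
  rewrite (eq_bigr (fun=> n.+1%:R^-1)) => [|t _].
    by rewrite sumr_const card_ord -[LHS]mulr_natr mulVf ?pnatr_eq0.
  rewrite dotZl dotZr mulrA Q_uniform s2 dot_walk//; last exact: reflection_query.
  by rewrite /e /dot trmx_delta mul_delta_mx mxE !eqxx mulr1.
rewrite /error_probability YE /=.
under eq_bigr do rewrite norm_kervec.
rewrite (sum_enum_val (fun a => (bstate Y a ^+ 2)%:C%C)
                      (fun a => (branch a == ord0) != b)).
rewrite -rmorph_sum /=; congr (_%:C%C).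
rewrite big_mkcond sum_glue /=.
have sumh t : \sum_h bstate Y (glue h t) ^+ 2 = dot (Y t) (Y t).
  rewrite dotE -sum_enum_rank; apply: eq_bigr => h _.
  by rewrite /bstate site_glue expr2.
have -> : \sum_t \sum_h (if (branch (glue h t) == ord0) != b
    then bstate Y (glue h t) ^+ 2 else 0) =
    \sum_(t | (t == ord0) != b) dot (Y t) (Y t).
  rewrite [RHS]big_mkcond; apply: eq_bigr => t _.
  by case: ifP => _; rewrite ?sumh// big1.
have := sumY; rewrite (bigD1 0)//= Y0 => <-.
case: b; first by rewrite [p + _]addrC addrK; apply: eq_bigl => t; rewrite eqb_id.
by rewrite (big_pred1 0) ?Y0// => t; rewrite eqbF_neg negbK.
Qed.
End WalkAlgorithm.

(** * Dual adversary vectors *)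

Section DualAdversary.
Variables (R : realType) (N : nat) (K : finType).
Local Notation H := (qbasis N (option K)).

Definition sitevec (G : H -> R) : 'cV[R]_#|{: H}| := \col_k G (enum_val k).

Lemma dot_sitevec G G' : dot (sitevec G) (sitevec G') = \sum_h G h * G' h.
Proof.
rewrite dotE -sum_enum_rank; apply: eq_bigr => h _.
by rewrite !mxE enum_rankK.
Qed.

(** On [Some] sites, conjugation by a query turns this sign into [+1] on correct and [-1] on wrong
    answers; [None] sites, among them the start, keep [+1]. *)
Definition site_sign (h : H) : R := if h.2 is Some _ then (-1) ^+ h.1.2 else 1.

Definition sign_mx : 'M[R]_#|{: H}| :=
  diag_mx (\row_k site_sign (enum_val k)).

Lemma reflection_sign : reflection sign_mx.
Proof.
split; first exact: tr_diag_mx.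
rewrite mulmx_diag -[RHS]diag_const_mx; congr diag_mx; apply/rowP => k.
rewrite !mxE /site_sign; case: (enum_val k).2 => [_|]; rewrite ?mulr1//.
by rewrite -expr2 sqrr_sign.
Qed.

Lemma query_mx_sitevec z G :
  query_mx R (option K) z *m sitevec G = sitevec (fun h => G (query z h)).
Proof.
apply/colP => k; rewrite !mxE -sum_enum_rank (bigD1 (query z (enum_val k)))//=.
rewrite !mxE enum_rankK queryK eqxx mul1r big1 ?addr0// => h hk.
rewrite mxE enum_rankK -(inj_eq (inv_inj (@queryK _ (option K) z))) queryK.
by rewrite eq_sym (negbTE hk) mul0r.
Qed.

Lemma sign_mx_sitevec G :
  sign_mx *m sitevec G = sitevec (fun h => site_sign h * G h).
Proof. by apply/colP => k; rewrite mul_diag_mx !mxE. Qed.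

Lemma query_sign_sitevec z G : query_reflection sign_mx z *m sitevec G =
  sitevec (fun h => site_sign (query z h) * G h).
Proof.
rewrite /query_reflection -!mulmxA query_mx_sitevec sign_mx_sitevec.
rewrite query_mx_sitevec; congr sitevec; apply/funext => h.
by rewrite queryK.
Qed.

Variable i0 : 'I_N.
Let h0 : H := (i0, false, None).

Lemma delta_sitevec : delta_mx (enum_rank h0) 0 = sitevec (fun h => (h == h0)%:R).
Proof.
apply/colP => k; rewrite !mxE andbT; congr (nat_of_bool _)%:R.
by rewrite -(inj_eq enum_val_inj) enum_rankK.
Qed.

(* The witness [|h0> + c sum_j |j, s + z_j> v_j], which lies in the range of the
   projector onto [h0] and the correct answers if [s = false]. *)
Definition witness (s : bool) (c : R) (z : bitstring N) (v : 'I_N -> K -> R) :=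
  sitevec (fun h => if h.2 is Some k
    then (h.1.2 == s (+) z h.1.1)%:R * (c * v h.1.1 k) else (h == h0)%:R).

Lemma sum_option (V : nmodType) (G : option K -> V) :
  \sum_o G o = G None + \sum_k G (Some k).
Proof.
rewrite (bigD1 None)//=; congr (_ + _).
by rewrite (reindex_omap Some id) => [|[]//]; apply: eq_bigl => k /=; rewrite eqxx.
Qed.

Lemma sum_site (V : nmodType) (G : H -> V) :
  \sum_h G h = \sum_i \sum_b (G (i, b, None) + \sum_k G (i, b, Some k)).
Proof.
transitivity (\sum_i \sum_b \sum_o G (i, b, o)).
  rewrite pair_bigA pair_bigA /=.
  by under [RHS]eq_bigr do rewrite -!surjective_pairing.
by apply: eq_bigr => i _; apply: eq_bigr => b _; exact: sum_option.
Qed.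

(** Two witnesses meet at [i] only if their answer bits agree: everywhere if flags and inputs are
    equal, exactly where [z] and [z'] differ if the flags are opposite. *)
Lemma dot_witness s c z v s' c' z' v' :
  dot (witness s c z v) (witness s' c' z' v') =
  1 + c * c' * \sum_(i | s (+) z i == s' (+) z' i) \sum_k v i k * v' i k.
Proof.
rewrite dot_sitevec sum_site.
under eq_bigr do rewrite big_split /=.
rewrite big_split /=; congr (_ + _).
  rewrite (bigD1 i0)//= (bigD1 false)//= eqxx mul1r !big1 ?addr0//.
  - by move=> i ii0; rewrite big1// => b _; rewrite !xpair_eqE (negbTE ii0) mul0r.
  - by move=> b b0; rewrite !xpair_eqE (negbTE b0) andbF mul0r.
rewrite mulr_sumr [RHS]big_mkcond; apply: eq_bigr => i _.
rewrite exchange_big /= mulr_sumr.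
case: ifP => zz; last first.
  rewrite big1// => k _; rewrite big_bool.
  by move: zz; case: (s (+) z i); case: (s' (+) z' i) => //= _;
    rewrite !(mul0r, mulr0, add0r).
apply: eq_bigr => k _; rewrite big_bool /= (eqP zz).
by case: (s' (+) z' i); rewrite !(mul1r, mul0r, add0r, addr0) mulrACA.
Qed.

Lemma dot_witness_delta s c z v :
  dot (witness s c z v) (delta_mx (enum_rank h0) 0) = 1.
Proof.
rewrite delta_sitevec dot_sitevec (bigD1 h0)//= !eqxx mulr1 big1 ?addr0//.
by move=> h /negbTE ->; rewrite mulr0.
Qed.

(** With [s = false] all answers are correct and the vector is fixed; with [s = true] all are wrong
    and only the start component keeps its sign. *)
Lemma query_sign_witness s c z v :
  query_reflection sign_mx z *m witness s c z v =
  if s then 2 *: delta_mx (enum_rank h0) 0 - witness s c z v else witness s c z v.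
Proof.
rewrite query_sign_sitevec delta_sitevec.
have -> : (if s then 2 *: sitevec (fun h => (h == h0)%:R) - witness s c z v
           else witness s c z v) = sitevec (fun h => if s then 2 * (h == h0)%:R -
    (if h.2 is Some k then (h.1.2 == s (+) z h.1.1)%:R * (c * v h.1.1 k)
     else (h == h0)%:R)
  else (if h.2 is Some k then (h.1.2 == s (+) z h.1.1)%:R * (c * v h.1.1 k)
        else (h == h0)%:R)).
  by apply/colP => k; case: (s); rewrite !mxE.
congr sitevec; apply/funext => -[[i b] [k|]]; rewrite /site_sign /= ?mul1r; last first.
  by case: s => //; ring.
have -> : ((i, b, Some k) == h0) = false by rewrite !xpair_eqE andbF.
by case: s => /=; case: b; case: (z i) => /=; rewrite ?expr1 ?expr0; ring.
Qed.

Lemma query_sign_start z : query_reflection sign_mx z *m delta_mx (enum_rank h0) 0 =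
  delta_mx (enum_rank h0) 0 :> 'cV_#|{: H}|.
Proof.
rewrite delta_sitevec query_sign_sitevec; congr sitevec; apply/funext => h.
by have [->|] := eqVneq h h0; rewrite ?mul1r// mulr0.
Qed.
End DualAdversary.

(** [c] trades the squared norm of [psi y], at most [3 / 2], against that of [phi x], at most
    [(n + 1)^2 / 3]. The mean has [n + 1] terms but needs only [n] steps of two queries. *)
Lemma dual_adversary_algorithm (R : realType) (N : nat) (Z : {set bitstring N})
    (f : {z in Z} -> bool) (K : finType) (v : {z in Z} -> 'I_N -> K -> R)
    (c : R) (n : nat) : (0 < N)%N -> c != 0 ->
  (forall x y, ~~ f x -> f y ->
    \sum_(i | val x i != val y i) \sum_k v x i k * v y i k = 1) ->
  (forall y, f y -> 2 * (c ^+ 2 * \sum_i \sum_k v y i k ^+ 2) <= 1) ->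
  (forall x, ~~ f x ->
    3 * (1 + (\sum_i \sum_k v x i k ^+ 2) / c ^+ 2) <= n.+1%:R ^+ 2) ->
  exists A : query_algorithm R N, computes A n.*2 f.
Proof.
move=> N0 c0 adv pos neg; pose i0 := Ordinal N0.
pose psi y := witness i0 false c (val y) (v y).
pose phi x := witness i0 true (- c^-1) (val x) (v x).
have [M reflM [Mfix Mneg]] := span_reflection [seq psi y | y <- enum [pred y | f y]].
have [Q reflQ Q_uniform] := @uniform_reflection R n.
have reflD := @reflection_sign R N K.
have start := @query_sign_start R N K i0.
exists (walk_algorithm (i0, false, None) reflD reflM reflQ) => z.
rewrite walk_algorithm_error//.
set p := dot _ _.
suff : (if f z then 1 - p else p) <= 3^-1.
  by rewrite -lecR => /le_trans; apply; rewrite rmorphV ?unitfE ?pnatr_eq0// rmorph_nat.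
have Fz := reflection_query reflD (val z).
case: ifPn => fz.
  suff : 2 / 3 <= p by lra.
  apply: (walk_mean_accept Fz reflM (psi := psi z)) => //.
  - by rewrite query_sign_witness.
  - by apply: Mfix; apply/mapP; exists z; rewrite // mem_enum.
  - exact: dot_witness_delta.
  - rewrite dot_witness (eq_bigl xpredT) => [|i]; last by rewrite eqxx.
    rewrite -expr2; have := pos _ fz.
    by under [in X in X -> _]eq_bigr do under eq_bigr do rewrite expr2; lra.
apply: (walk_mean_reject Fz reflM (phi := phi z)) => //.
- by rewrite query_sign_witness.
- apply: Mneg => w /mapP[y]; rewrite mem_enum => fy ->.
  (* The scales [- c^-1] and [c] multiply to [-1], so the inner product is 1 minus the adversary
     sum. *)
  rewrite dot_witness mulrN divff// (eq_bigl (fun i => val z i != val y i)) => [|i].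
    under eq_bigr do under eq_bigr do rewrite mulrC.
    by rewrite adv// mulr1 subrr.
  by rewrite /=; case: (val y i); case: (val z i).
- rewrite dot_witness (eq_bigl xpredT) => [|i]; last by rewrite eqxx.
  rewrite mulrNN -invfM -expr2 [_^-1 * _]mulrC; have := neg _ fz.
  by under [in X in X -> _]eq_bigr do under eq_bigr do rewrite expr2.
Qed.

(** * Learning graphs *)

(** The net outflow of [A] is 1: the root gives 1 and all other vertices of [A] conserve the flow,
    not being sinks. Edges inside [A] cancel and none enters [A], so the cut carries it all. *)
Lemma unit_flow_cut (R : realType) (V : finType) (edge : rel V)
    (p : V -> V -> R) (r : V) (A : {pred V}) :
  unit_flow_from edge p r -> r \in A ->
  (forall v, v \in A -> ~ flow_sink edge p v) ->
  (forall u v, edge u v -> v \in A -> u \in A) ->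
  \sum_(e : V * V | [&& edge e.1 e.2, e.1 \in A & e.2 \notin A]) p e.1 e.2 = 1.
Proof.
move=> [_ rflow vflow] rA nosink backA.
have outA : \sum_(v in A) outflow edge p v =
    \sum_(u in A) \sum_(v | edge u v && (v \in A)) p u v +
    \sum_(u in A) \sum_(v | edge u v && (v \notin A)) p u v.
  rewrite -big_split; apply: eq_bigr => u _ /=.
  by rewrite /outflow (bigID [in A]).
have inA : \sum_(v in A) inflow edge p v =
    \sum_(u in A) \sum_(v | edge u v && (v \in A)) p u v.
  rewrite (exchange_big_dep [in A])/= => [|v u vA uv]; last exact: backA uv vA.
  by apply: eq_bigr => u uA; apply: eq_bigl => v; rewrite andbC.
have netA : \sum_(v in A) (outflow edge p v - inflow edge p v) = 1.
  rewrite (bigD1 r)//= rflow big1 ?addr0// => v /andP[vA vr].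
  apply/eqP; rewrite subr_eq0 eq_le vflow//= leNgt.
  by apply/negP; exact: nosink.
rewrite -netA sumrB outA inA addrAC subrr add0r.
rewrite pair_big_dep; apply: eq_bigl => e /=.
by rewrite andbCA.
Qed.

(** For constant [f] a maximum over the empty set makes [lg_C] zero, so the bound leaves room for no
    query at all. *)
Lemma constant_algorithm (R : realType) (N : nat) (Z : {set bitstring N})
    (f : {z in Z} -> bool) (b : bool) : (0 < N)%N -> (forall z, f z = b) ->
  exists A : query_algorithm R N, computes A 0 f.
Proof.
move=> N0 fb.
have id_unitary (t : nat) : (1%:M : 'M[R[i]]_#|{: qbasis N unit}|) \is unitarymx.
  by apply/unitarymxP; rewrite trmx1 map_mx1 mulmx1.
exists (QueryAlgorithm (Ordinal N0, false, tt) id_unitary (fun=> b)) => z.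
rewrite /error_probability big_pred0 => [|k]; last by rewrite /= fb eqxx.
by rewrite invr_ge0 ler0n.
Qed.

(** * Adversary vectors of a learning graph *)

Section GraphVectors.
Variables (R : realType) (N : nat) (Z : {set bitstring N}) (f : {z in Z} -> bool).
Variable G : ext_learning_graph R [set y | f y]%SET.
Local Notation V := (lg_vertex G).
Local Notation edge := (@lg_edge _ _ _ _ G).
Local Notation label := (@lg_label _ _ _ _ G).

(** For fixed [S] this encodes the restriction of [z] to [S] in a finite type. *)
Definition ones_in (z : {z in Z}) (S : {set 'I_N}) : {set 'I_N} :=
  [set i in S | val z i]%SET.

Lemma ones_in_eq (z z' : {z in Z}) (S : {set 'I_N}) :
  reflect {in S, val z =1 val z'} (ones_in z S == ones_in z' S).
Proof.
apply: (iffP eqP) => [/setP zz i iS|zz].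
  by have := zz i; rewrite !inE iS.
by apply/setP => i; rewrite !inE; case: (boolP (i \in S)) => //= /zz ->.
Qed.

Definition amplitude (z : {z in Z}) (e : V * V) : R :=
  if f z then lg_p z e.1 e.2 / Num.sqrt (lg_w true z e.1 e.2)
  else Num.sqrt (lg_w false z e.1 e.2).

Definition graph_vector (z : {z in Z}) (j : 'I_N)
    (k : V * V * {set 'I_N}) : R :=
  if [&& edge k.1.1 k.1.2, j \in label k.1.2 :\: label k.1.1 &
         k.2 == ones_in z (label k.1.1)]
  then amplitude z k.1 else 0.

(** An edge loads one position and carries one tag per input, so the sum over positions and tags
    collapses to at most one term per edge. *)
Lemma dot_graph_vector (P : pred 'I_N) (z z' : {z in Z}) :
  \sum_(j | P j) \sum_k graph_vector z j k * graph_vector z' j k =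
  \sum_(e | [&& edge e.1 e.2, ones_in z (label e.1) == ones_in z' (label e.1) &
                [exists j in label e.2 :\: label e.1, P j]])
     amplitude z e * amplitude z' e.
Proof.
rewrite exchange_big /= -(pair_bigA _ (fun e g => \sum_(j | P j)
  graph_vector z j (e, g) * graph_vector z' j (e, g))) /=.
rewrite [RHS]big_mkcond; apply: eq_bigr => e _.
rewrite (bigD1 (ones_in z (label e.1)))//= [X in _ + X]big1 => [|g gz]; last first.
  rewrite big1// => j _; rewrite /graph_vector /= (negbTE gz) !andbF.
  by rewrite mul0r.
rewrite addr0; case: ifPn => [/and3P[ee zz /existsP[j0 /andP[j0e Pj0]]]|].
  rewrite (bigD1 j0)//= big1 => [|j /andP[_ jj0]].
    by rewrite /graph_vector /= ee j0e eqxx zz addr0.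
  have [j1 _ l1] := lg_label_edge ee; rewrite /graph_vector /=.
  suff -> : (j \in label e.2 :\: label e.1) = false by rewrite andbF mul0r.
  apply/negP; move: j0e; rewrite l1 !inE => /andP[/negbTE -> /orP[/eqP j01|//]].
  by rewrite -j01 (negbTE jj0) /= => /andP[/negbTE ->].
move=> nee; rewrite big1// => j Pj; rewrite /graph_vector /=.
case: ifP => [/and3P[ee je _]|]; last by rewrite mul0r.
case: ifP => [/and3P[_ _ zz]|]; last by rewrite mulr0.
case/negP: nee; rewrite ee zz /=; apply/existsP; exists j.
by rewrite je.
Qed.

Lemma norm_graph_vector (z : {z in Z}) : \sum_j \sum_k graph_vector z j k ^+ 2 =
  if f z then lg_C1_at G z else lg_C0_at G z.
Proof.
under eq_bigr do under eq_bigr do rewrite expr2.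
rewrite dot_graph_vector (eq_bigl (fun e => edge e.1 e.2)) => [|e]; last first.
  rewrite eqxx /=; case: (boolP (edge e.1 e.2)) => //= /lg_label_edge[j ju lv].
  by apply/existsP; exists j; rewrite lv !inE ju eqxx.
case: ifPn => fz; apply: eq_bigr => e ee; rewrite /amplitude ?fz ?(negbTE fz).
  by rewrite -expr2 expr_div_n sqr_sqrtr// lg_w_ge0.
by rewrite -expr2 sqr_sqrtr// lg_w_ge0.
Qed.

Lemma graph_vector_adversary (x y : {z in Z}) : lg_for G -> ~~ f x -> f y ->
  \sum_(j | val x j != val y j)
    \sum_k graph_vector x j k * graph_vector y j k = 1.
Proof.
move=> Gf fx fy; rewrite dot_graph_vector.
have yY : y \in [set y | f y]%SET by rewrite inE.
(* The edges leaving [A] are those from [A] that load a position where [x] and [y] differ. *)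
pose A := [pred v | ones_in x (label v) == ones_in y (label v)].
rewrite -(unit_flow_cut (A := A) (lg_p_flow G yY)).
- apply: eq_big => [e|e /and3P[ee xy /existsP[j /andP[je xyj]]]].
    apply: andb_id2l => ee; rewrite !inE; apply: andb_id2l => /ones_in_eq xy.
    apply/existsP/idP => [[j /andP[je /eqP xyj]]|/negP nA].
      by apply/ones_in_eq => xyv; apply: xyj; apply: xyv; case/setDP: je.
    have [j ju lv] := lg_label_edge ee; exists j.
    rewrite !inE ju lv !inE eqxx /=; apply/eqP => xyj; apply: nA.
    by apply/ones_in_eq => i; rewrite lv !inE => /predU1P[->|/xy].
  rewrite /amplitude (negbTE fx) fy.
  have [j1 ju lv] := lg_label_edge ee.
  have jj1 : j = j1.
    by move: je; rewrite lv !inE => /andP[/negbTE ->]; rewrite orbF => /eqP.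
  have -> : lg_w false x e.1 e.2 = lg_w true y e.1 e.2.
    apply: (@lg_w_compat _ _ _ _ G x y e.1 e.2 j1) => //; first by rewrite inE.
      exact/ones_in_eq.
    by rewrite -jj1.
  (* At weight 0 the square roots do not cancel, but the flow vanishes there. *)
  have [w0|w0] := eqVneq (lg_w true y e.1 e.2) 0.
    by rewrite w0 sqrtr0 mul0r (lg_p_supp yY ee w0).
  by rewrite mulrC divfK// sqrtr_eq0 -ltNge lt_neqAle eq_sym w0 lg_w_ge0.
- by rewrite inE /= lg_label_root; apply/ones_in_eq => i; rewrite inE.
- move=> v /ones_in_eq xyv sv; have [I Iv cert] := Gf y v fy sv.
  by case/negP: fx; apply: cert => i iI; apply/xyv/(fintype.subsetP Iv).
- move=> u v ee /ones_in_eq xyv; apply/ones_in_eq => i iu.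
  by have [j _ lv] := lg_label_edge ee; apply: xyv; rewrite lv !inE iu orbT.
Qed.

Lemma lg_C0_ge0 : 0 <= lg_C0 G. Proof. exact: bigmax_ge_id. Qed.

Lemma lg_C1_ge0 : 0 <= lg_C1 G. Proof. exact: bigmax_ge_id. Qed.

(** Cauchy-Schwarz, through a quadratic in [l] that is never negative. The bound absorbs the
    additive constants of the query count. *)
Lemma lg_C0_C1_ge1 (x y : {z in Z}) : lg_for G -> ~~ f x -> f y -> 1 <= lg_C0 G * lg_C1 G.
Proof.
move=> Gf fx fy.
have A0 := lg_C0_ge0; have B0 := lg_C1_ge0.
have xA : lg_C0_at G x <= lg_C0 G by apply: le_bigmax_cond.
have yB : lg_C1_at G y <= lg_C1 G by apply: le_bigmax_cond.
have quad l : 0 <= lg_C0 G - 2 * l + l ^+ 2 * lg_C1 G.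
  have le_all z : \sum_(j | val x j != val y j) \sum_k graph_vector z j k ^+ 2 <=
      if f z then lg_C1_at G z else lg_C0_at G z.
    rewrite -norm_graph_vector [leRHS](bigID (fun j => val x j != val y j)) /=.
    rewrite lerDl; apply: sumr_ge0 => j _; apply: sumr_ge0 => k _.
    exact: sqr_ge0.
  have := le_all x; have := le_all y; rewrite fy (negbTE fx) => yle xle.
  have : 0 <= \sum_(j | val x j != val y j)
      \sum_k (graph_vector x j k - l * graph_vector y j k) ^+ 2.
    by apply: sumr_ge0 => j _; apply: sumr_ge0 => k _; exact: sqr_ge0.
  under eq_bigr do under eq_bigr do rewrite sqrrB exprMn mulrCA -mulrnAr.
  under eq_bigr do rewrite big_split sumrB -!mulr_sumr /=.
  rewrite big_split sumrB -!mulr_sumr /= => /le_trans; apply.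
  apply: lerD; last by rewrite ler_wpM2l ?sqr_ge0// (le_trans yle).
  under [X in _ - l * X]eq_bigr do rewrite sumrMnl.
  rewrite sumrMnl graph_vector_adversary// mulrC mulr_natl lerB//.
  exact: le_trans xA.
(* If [lg_C0 G = 0], a small positive [l] makes the quadratic negative; otherwise [l = lg_C0 G]
   gives the bound. *)
have [A_0|A_0] := eqVneq (lg_C0 G) 0.
  have := quad (lg_C1 G + 1)^-1; rewrite A_0.
  have B1 : 0 < lg_C1 G + 1 by lra.
  rewrite (_ : _ + _ = (lg_C1 G + 1)^-1 ^+ 2 * (- lg_C1 G - 2)); last by field; lra.
  by rewrite pmulr_rge0 ?exprn_gt0 ?invr_gt0//; lra.
have := quad (lg_C0 G).
rewrite (_ : _ + _ = lg_C0 G * (lg_C0 G * lg_C1 G - 1)); last by ring.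
by rewrite pmulr_rge0 ?subr_ge0// lt_neqAle eq_sym A_0.
Qed.

Lemma graph_algorithm : (0 < N)%N -> lg_for G ->
  exists T (A : query_algorithm R N), computes A T f /\ T%:R <= 6 * lg_C G.
Proof.
move=> N0 Gf; set C := lg_C G.
have C_ge0 : 0 <= C by exact: sqrtr_ge0.
have [/existsP[x fx]|/existsPn f1] := boolP [exists x, ~~ f x]; last first.
  have [|A fA] := @constant_algorithm R N Z f true N0.
    by move=> z; have := f1 z; rewrite negbK => ->.
  by exists 0%N, A; split=> //; rewrite mulr_ge0.
have [/existsP[y fy]|/existsPn f0] := boolP [exists y, f y]; last first.
  have [|A fA] := @constant_algorithm R N Z f false N0.
    by move=> z; apply/negbTE/f0.
  by exists 0%N, A; split=> //; rewrite mulr_ge0.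
have AB1 := lg_C0_C1_ge1 Gf fx fy.
have A0 := lg_C0_ge0; have B0 := lg_C1_ge0.
have B_gt0 : 0 < lg_C1 G.
  by rewrite lt_neqAle B0 andbT; apply/eqP => B_0; move: AB1; rewrite -B_0; lra.
have C2 : C ^+ 2 = lg_C0 G * lg_C1 G by rewrite sqr_sqrtr// mulr_ge0.
have C1 : 1 <= C by rewrite -(@ler_pXn2r _ 2) ?nnegrE// expr1n C2.
(* [n <= 3 C] bounds the [2 n] queries by [6 C], while [1 <= C] gives
   [3 (1 + 2 C^2) <= 9 C^2 <= (n + 1)^2]. *)
pose n := Num.truncn (3 * C).
have /andP[nle nlt] : n%:R <= 3 * C < n.+1%:R by rewrite truncn_itv ?mulr_ge0.
(* The largest scale that [lg_C1 G] allows for the positive inputs. *)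
pose c : R := (Num.sqrt (2 * lg_C1 G))^-1.
have c2 : c ^+ 2 = (2 * lg_C1 G)^-1 by rewrite exprVn sqr_sqrtr// mulr_ge0.
have c0 : c != 0 by rewrite invr_neq0// gt_eqF// sqrtr_gt0 mulr_gt0.
have [|||A fA] := @dual_adversary_algorithm R N Z f _ graph_vector c n N0 c0.
- by move=> x' y' fx' fy'; exact: graph_vector_adversary.
- move=> y' fy'; rewrite norm_graph_vector fy' c2 invfM !mulrA.
  rewrite divff ?pnatr_eq0// mul1r ler_pdivrMl// mulr1.
  exact: le_bigmax_cond.
- move=> x' fx'; rewrite norm_graph_vector (negbTE fx') c2 invrK.
  have xA : lg_C0_at G x' <= lg_C0 G by apply: le_bigmax_cond.
  have xB : lg_C0_at G x' * lg_C1 G <= C ^+ 2 by rewrite C2 ler_wpM2r.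
  have : (3 * C) ^+ 2 <= n.+1%:R ^+ 2.
    by rewrite ler_pXn2r ?nnegrE ?ler0n ?mulr_ge0// ltW.
  have : 1 <= C ^+ 2 by rewrite C2.
  rewrite exprMn; lra.
exists n.*2, A; split=> //.
by rewrite -muln2 natrM; lra.
Qed.
End GraphVectors.

Theorem theorem3p3 (R : realType) :
  exists2 K : R, 0 < K &
    forall (N : nat) (Z : {set bitstring N}) (f : {z in Z} -> bool),
      (0 < N)%N ->
      (quantum_query_complexity R f <= K%:E * ext_lg_complexity R f)%E.
Proof.
exists 6; first by rewrite ltr0n.
(* Dividing by 6 isolates the infimum, so one graph at a time can be treated. *)
move=> N Z f N0; rewrite -lee_pdivrMl ?ltr0n//.
apply/ereal_infP => _ [G Gf ->]; rewrite lee_pdivrMl ?ltr0n// -EFinM.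
have [T [A [fA TC]]] := graph_algorithm N0 Gf.
apply: ge_ereal_inf; exists (T%:R)%:E; last by rewrite lee_fin.
by exists T => //; exists A.
Qed.
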